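(* The maps $\Phi$ and $\Psi$ are mutually inverse: (i) for every decreasing tableau $P$, removable cell $(r,c)$ of $P$ and $\alpha\in\{0,1\}$, if $\Psi(P,(r,c),\alpha)=(P',m)$ then $\Phi(P',m)=(P,(r,c),\alpha)$; (ii) for every decreasing tableau $P$ and $m\in\mathbb{Z}_{>0}$, if $\Phi(P,m)=(P',(r,c),\alpha)$ then $\Psi(P',(r,c),\alpha)=(P,m)$.
   Context: Tableaux use English notation; cell $(i,j)$ is in row $i$, column $j$. A decreasing tableau is a filling of the diagram of a partition by positive integers strictly decreasing from left to right along rows and from top to bottom along columns. A cell is removable if it is the last cell of its row and the bottom cell of its column. $P_{>r}$ denotes the tableau obtained by deleting the first $r$ rows of $P$ (rows renumbered from 1), $P_{\ge r}=P_{>r-1}$. A value $x$ is $P$-ejectable if $x$ occurs in the first row of $P$ and either $x-1$ does not occur in the first row, or $x-1$ occurs in the first row and $x-1$ is $P_{>1}$-ejectable (nothing is ejectable in the empty tableau). Bumping path of a removable cell $(r,c)$ of $P$: $m_r$ is the entry at $(r,c)$, and for $i=r-1,\dots,1$, $m_i$ is the smallest entry of row $i$ with $m_i>m_{i+1}$. Reverse insertion $\Psi(P,(r,c),\alpha)=(P',m)$: compute the bumping path $m_r<\dots<m_1$; set $m:=m_1$, $P':=P$. If $\alpha=1$, delete cell $(r,c)$ from $P'$, set $\alpha_r=1$, and process rows $i=r-1,\dots,1$. If $\alpha=0$, set $m_{r+1}=0$, $\alpha_{r+1}=0$, and process rows $i=r,\dots,1$. Processing row $i$ with $R$ the set of entries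 of row $i$ of $P$: (D) if $m_i-1\in R$, leave row $i$, $\alpha_i=\alpha_{i+1}$; (DR) else if $\alpha_{i+1}=1$ and $m_{i+1}\notin R$, replace $m_i$ in row $i$ of $P'$ by $m_{i+1}$, $\alpha_i=1$; otherwise let $x$ be the smallest $P'_{>i}$-ejectable value (current $P'$) with $m_{i+1}<x<m_i$: (IR) if $x$ exists replace $m_i$ by $x$, $\alpha_i=1$; (NR) else leave row $i$, $\alpha_i=0$. Output final $P'$ and $m$. Insertion $\Phi(P,m)=(P',(r,c),\alpha)$: set $P':=P$, $N:=m$, $i:=1$. At iteration $i$, let $R$ be the set of entries of row $i$ of $P$ (empty if no such row), $n_1$ the largest element of $R$ with $n_1\le N$. (T1) If $n_1$ does not exist, append $N$ at the end of row $i$ of $P'$ and output $(P',\text{new cell},1)$. Otherwise replace $n_1$ in row $i$ of $P'$ by $N$, and: (D) if $n_1=N$ and $N-1\in R$, set $N:=N-1$, next iteration; (DR) else if $n_1<N$ and $n_1$ is not $P_{>i}$-ejectable, set $N:=n_1$, next iteration; otherwise let $n_2$ be the entry immediately right of $n_1$ in row $i$ of $P$ ($0$ if none) and $y$ the largest $P_{>i}$-ejectable value with $n_2<y<n_1$: (IR1) if $y$ exists, $N:=y$, next iteration; (IR2) if not and $n_2>0$, $N:=n_2$, next iteration; (T2) if not and $n_2=0$, output $(P',\text{the cell of } N \text{ in row } i,0)$. *)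

(* Defs.v *)
From mathcomp Require Import all_boot.

Set Implicit Arguments.
Unset Strict Implicit.
Unset Printing Implicit Defensive.

(* A tableau is its list of rows, from top to bottom.  Rows and columns are    *)
(* numbered from 1, and the diagram of a partition has no empty row, so that   *)
(* the empty tableau is [::] and every diagram has a single representation.    *)
Definition tableau := seq (seq nat).

Definition row (P : tableau) (i : nat) : seq nat := nth [::] P i.-1.

Definition in_diagram (P : tableau) (i j : nat) : bool :=
  [&& 0 < i, 0 < j & j <= size (row P i)].

(* [dominates R1 R2]: R2 can be placed directly below R1. *)
Definition dominates (R1 R2 : seq nat) : bool :=
  (size R2 <= size R1) &&
  all (fun j => nth 0 R2 j < nth 0 R1 j) (iota 0 (size R2)).

Definition decreasing_tableau (P : tableau) : bool :=
  all (fun R => [&& R != [::], all (fun x => 0 < x) R & sorted gtn R]) P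
  && sorted dominates P.

Definition removable (P : tableau) (rc : nat * nat) : bool :=
  let: (r, c) := rc in
  [&& in_diagram P r c, ~~ in_diagram P r c.+1 & ~~ in_diagram P r.+1 c].

Fixpoint ejectable (P : tableau) (x : nat) : bool :=
  if P is R :: Q then (x \in R) && ((x.-1 \notin R) || ejectable Q x.-1)
  else false.

Definition smallest (p : pred nat) (s : seq nat) : option nat :=
  ohead (sort leq (filter p s)).

Definition largest (p : pred nat) (s : seq nat) : option nat :=
  ohead (sort geq (filter p s)).

(* Ejectable values occur in the first row, so searching it is enough. *)
Definition smallest_ejectable (P : tableau) (a b : nat) : option nat :=
  smallest (fun x => ejectable P x && (a < x < b)) (head [::] P).

Definition largest_ejectable (P : tableau) (a b : nat) : option nat :=
  largest (fun y => ejectable P y && (a < y < b)) (head [::] P).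

Definition replace (x y : nat) (R : seq nat) : seq nat :=
  [seq if z == x then y else z | z <- R].

(* Processing of row i in the reverse insertion: R is row i of P, Q' is the    *)
(* current P'_{>i}, m = m_i, m' = m_{i+1} and a' = alpha_{i+1}.  The result is *)
(* the new row i together with alpha_i.                                        *)
Definition process_row (R : seq nat) (Q' : tableau) (m m' : nat) (a' : bool) :
    seq nat * bool :=
  if m.-1 \in R then (R, a')                                          (* D  *)
  else if a' && (m' \notin R) then (replace m m' R, true)             (* DR *)
  else if smallest_ejectable Q' m' m is Some x
       then (replace m x R, true)                                     (* IR *)
       else (R, false).                                               (* NR *)

(* The rows of P are P_{>=i} for the current row i, and r is the row of the    *)
(* cell relative to them; since P'_{>i} is final when row i is processed, it   *)
(* is the result of the recursive call.  The result is (P'_{>=i}, m_i,         *)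
(* alpha_i), where m_i is the entry of the bumping path in row i.  The values  *)
(* given when (r, c) is not a cell are junk.                                   *)
Fixpoint reverse_insert (P : tableau) (r c : nat) (a : bool) :
    tableau * nat * bool :=
  match P, r with
  | R :: Q, 1 =>
      let m := nth 0 R c.-1 in
      if a then
        let R' := take c.-1 R in
        (if R' is [::] then Q else R' :: Q, m, true)
      else
        let: (R', a0) := process_row R Q m 0 false in (R' :: Q, m, a0)
  | R :: Q, r'.+1 =>
      let: (Q', m', a') := reverse_insert Q r' c a in
      let m := odflt 0 (smallest (fun x => m' < x) R) in
      let: (R', a0) := process_row R Q' m m' a' in (R' :: Q', m, a0)
  | _, _ => ([::], 0, false)
  end.

Definition Psi (P : tableau) (rc : nat * nat) (a : bool) : tableau * nat :=
  let: (P', m, _) := reverse_insert P rc.1 rc.2 a in (P', m).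

(* The rows of P are the original rows i, i+1, ...; past the last row, the     *)
(* set of entries of row i is empty and the insertion stops by T1.             *)
Fixpoint insert_from (i : nat) (P : tableau) (N : nat) :
    tableau * (nat * nat) * bool :=
  match P with
  | [::] => ([:: [:: N]], (i, 1), true)                               (* T1  *)
  | R :: Q =>
      if largest (fun n => n <= N) R is Some n1 then
        let R' := replace n1 N R in
        let next N' :=
          let: (Q', rc, a) := insert_from i.+1 Q N' in (R' :: Q', rc, a) in
        if (n1 == N) && (N.-1 \in R) then next N.-1                   (* D   *)
        else if (n1 < N) && ~~ ejectable Q n1 then next n1            (* DR  *)
        else
          let n2 := nth 0 R (index n1 R).+1 in
          if largest_ejectable Q n2 n1 is Some y then next y          (* IR1 *)
          else if 0 < n2 then next n2                                 (* IR2 *)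
          else (R' :: Q, (i, (index N R').+1), false)                 (* T2  *)
      else (rcons R N :: Q, (i, (size R).+1), true)                   (* T1  *)
  end.

Definition Phi (P : tableau) (m : nat) : tableau * (nat * nat) * bool :=
  insert_from 1 P m.

(* Main.v *)
(* Along the bumping path, alpha_i = 0 exactly when m_i is ejectable from the   *)
(* rows of the output tableau from row i on.  Hence alpha_{i+1} can be read off *)
(* from m_{i+1} and the rows below row i of the tableau before insertion, and   *)
(* with those rows fixed, each step is a bijection (R, N) <-> (R', N') on a     *)
(* single row: N enters row R, which becomes R', and N' is passed down.  The    *)
(* column condition is expressed by counting entries above each threshold,      *)
(* which only requires knowing what a bump does to these counts.  Induction on  *)
(* the rows concludes.                                                          *)
Require Import Defs.
From mathcomp Require Import all_boot zify.

Set Implicit Arguments.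
Unset Strict Implicit.
Unset Printing Implicit Defensive.

(** Fix a row [R] and the rows [Q] below it before insertion, with first row [A]. Insertion turns
    ([R], [N]) into ([R'], [N']), and reverse insertion must recover the former from [R'], [N'], [Q]
    and a bit. That bit is determined by [N'] and [Q]: it is 1 exactly when [N'] is positive and not
    [Q]-ejectable. The cases then pair up: D with D, DR with DR, and IR1, IR2, T2 with IR when
    [n < N] and with NR when [n = N]. Indeed, in the last group no value strictly between [N'] and
    [n] is ejectable, so for [n < N] the least ejectable value between [N'] and [N] is [n], and for
    [n = N] there is none. These pairings are [bump_forward] and [bump_backward].

    The rows must also remain stackable. By [fits_above_insert_row], [R'] can stand above the row
    that received [N'] exactly when it can stand above [A] and has more entries above [N'] than [A]
    has. [bump_forward] yields this pair of conditions and [bump_backward] starts from it.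
    [insert_fromK] and [reverse_insertK] glue the steps together. T2 is the bump with [N' = 0]; T1
    goes with bit 1, since the new entry is absent from the old row and hence not ejectable
    there. *)

Lemma gtn_trans : transitive gtn.
Proof. by move=> y x z /=; lia. Qed.

Lemma geq_trans : transitive geq.
Proof. by move=> y x z /=; lia. Qed.

(** * Extremal entries of a row *)

Lemma smallestP (p : pred nat) s :
  if smallest p s is Some x
  then [/\ x \in s, p x & forall z, z \in s -> p z -> x <= z]
  else forall z, z \in s -> ~~ p z.
Proof.
rewrite /smallest; have := mem_sort leq (filter p s).
have := sort_sorted leq_total (filter p s).
case: (sort _ _) => [_ /= e z zs|x t /= xt e].
  by apply/negP => pz; have := e z; rewrite mem_filter pz zs.
have := e x; rewrite mem_head mem_filter => /esym/andP[px xs]; split=> // z zs pz.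
have := e z; rewrite mem_filter pz zs inE => /orP[/eqP->//|zt].
by move: xt; rewrite path_sortedE; [case/andP=> /allP/(_ _ zt)|exact: leq_trans].
Qed.

Lemma largestP (p : pred nat) s :
  if largest p s is Some x
  then [/\ x \in s, p x & forall z, z \in s -> p z -> z <= x]
  else forall z, z \in s -> ~~ p z.
Proof.
have geq_total : total geq by move=> x y /=; lia.
rewrite /largest; have := mem_sort geq (filter p s).
have := sort_sorted geq_total (filter p s).
case: (sort _ _) => [_ /= e z zs|x t /= xt e].
  by apply/negP => pz; have := e z; rewrite mem_filter pz zs.
have := e x; rewrite mem_head mem_filter => /esym/andP[px xs]; split=> // z zs pz.
have := e z; rewrite mem_filter pz zs inE => /orP[/eqP->//|zt].
by move: xt; rewrite path_sortedE; [case/andP=> /allP/(_ _ zt)|exact: geq_trans].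
Qed.

Lemma smallest_eq (p : pred nat) s x : x \in s -> p x ->
  (forall z, z \in s -> p z -> x <= z) -> smallest p s = Some x.
Proof.
move=> xs px xmin; have := smallestP p s;
  case: smallest => [y [ys py ymin]|/(_ _ xs)].
  by congr Some; have := xmin _ ys py; have := ymin _ xs px; lia.
by rewrite px.
Qed.

Lemma largest_eq (p : pred nat) s x : x \in s -> p x ->
  (forall z, z \in s -> p z -> z <= x) -> largest p s = Some x.
Proof.
move=> xs px xmax; have := largestP p s;
  case: largest => [y [ys py ymax]|/(_ _ xs)].
  by congr Some; have := xmax _ ys py; have := ymax _ xs px; lia.
by rewrite px.
Qed.

Lemma smallest_none (p : pred nat) s :
  (forall z, z \in s -> ~~ p z) -> smallest p s = None.
Proof.
move=> h; have := smallestP p s; case: smallest => [y [ys py _]|//].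
by have := h _ ys; rewrite py.
Qed.

Lemma largest_none (p : pred nat) s :
  (forall z, z \in s -> ~~ p z) -> largest p s = None.
Proof.
move=> h; have := largestP p s; case: largest => [y [ys py _]|//].
by have := h _ ys; rewrite py.
Qed.

(** * Decreasing rows and the column condition by counting *)

Definition decreasing_row (R : seq nat) := all (fun x => 0 < x) R && sorted gtn R.

Lemma decreasing_row_pos R x : decreasing_row R -> x \in R -> 0 < x.
Proof. by case/andP=> /allP h _ /h. Qed.

Lemma decreasing_row_uniq R : decreasing_row R -> uniq R.
Proof.
by case/andP=> _; apply: sorted_uniq => [|x]; [exact: gtn_trans|rewrite /= ltnn].
Qed.

Definition cnt x (R : seq nat) := count (fun z => x < z) R.

(** The entries above [x] form an initial segment of a decreasing row, so positions and counts
    determine each other. *)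
Lemma ltn_nth_cnt R x j : sorted gtn R -> (x < nth 0 R j) = (j < cnt x R).
Proof.
elim: R j => [|y R IH] j; first by rewrite nth_nil /cnt /=; lia.
rewrite /= path_sortedE; last exact: gtn_trans.
case/andP=> /allP yR sR; rewrite /cnt /=.
have [xy|yx] := boolP (x < y).
  by case: j => [|j] /=; [rewrite xy|rewrite IH].
rewrite (@eq_in_count _ _ pred0) ?count_pred0 /=; last first.
  by move=> z /yR /=; lia.
case: j => [|j] /=; first lia.
have [jR|jR] := ltnP j (size R); last by rewrite nth_default // ltn0.
by have /= := yR _ (mem_nth 0 jR); lia.
Qed.

(** Column strictness read through thresholds: an entry above [x] needs an entry above [x.+1] on top
    of it. A bump changes each count by at most one, which makes this form easier to follow than
    [dominates]. *)
Definition fits_above (R A : seq nat) := forall x, cnt x A <= cnt x.+1 R.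

Lemma dominatesP R A : decreasing_row R -> decreasing_row A ->
  reflect (fits_above R A) (dominates R A).
Proof.
case/andP=> _ sR dA; have [/allP pA sA] := andP dA.
apply: (iffP andP) => [[szAR /allP h] x|h].
  case k: (cnt x A) => [//|j].
  have jA : j < size A
    by rewrite (leq_trans _ (count_size (fun z => x < z) A)) // -/(cnt x A) k.
  have := h j; rewrite mem_iota /= add0n => /(_ jA).
  have : x < nth 0 A j by rewrite ltn_nth_cnt // k.
  by rewrite -(ltn_nth_cnt x.+1 j) //; lia.
split.
  have -> : size A = cnt 0 A by apply/esym/eqP; rewrite -all_count; apply/allP.
  exact: leq_trans (h 0) (count_size _ _).
apply/allP => j; rewrite mem_iota /= add0n => jA.
have /= A0 := pA _ (mem_nth 0 jA).
have : j < cnt (nth 0 A j).-1 A by rewrite -ltn_nth_cnt //; lia.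
move=> /leq_trans/(_ (h _)); rewrite -ltn_nth_cnt //; lia.
Qed.

Lemma leq_cnt R x y : x <= y -> cnt y R <= cnt x R.
Proof. by move=> xy; apply: sub_count => z /=; lia. Qed.

Lemma cnt_gap R x y : x <= y -> (forall z, z \in R -> x < z -> y < z) ->
  cnt x R = cnt y R.
Proof. by move=> xy h; apply: eq_in_count => z /h /=; lia. Qed.

Lemma cnt_pred R x : uniq R -> 0 < x -> x \in R -> cnt x.-1 R = (cnt x R).+1.
Proof.
move=> uR x0 xR; have := count_predUI (fun z => x < z) (pred1 x) R.
rewrite count_uniq_mem // xR.
rewrite (@eq_count _ (predI _ _) pred0) ?count_pred0; last by move=> z /=; lia.
rewrite (@eq_count _ (predU _ _) (fun z => x.-1 < z)); last by move=> z /=; lia.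
by rewrite /cnt; lia.
Qed.

(** * Replacing one entry of a row *)

Lemma mem_replace R x y z : x \in R ->
  (z \in replace x y R) = (z == y) || (z \in R) && (z != x).
Proof.
move=> xR; apply/mapP/idP => [[w wR ->]|/orP[/eqP->|/andP[zR zx]]].
- by case: (eqVneq w x) => [_|wx]; [rewrite eqxx|rewrite wR wx orbT].
- by exists x; rewrite // eqxx.
- by exists z; rewrite // (negPf zx).
Qed.

Lemma replaceK R x y : (y \in R -> y = x) -> replace y x (replace x y R) = R.
Proof.
move=> h; rewrite /replace -map_comp map_id_in // => z zR /=.
case: (eqVneq z x) => [->|zx]; first by rewrite eqxx.
case: eqVneq => // zy; by rewrite zy h // -zy.
Qed.

Lemma replace_id R x : replace x x R = R.
Proof. by rewrite /replace map_id_in // => z _; case: eqVneq. Qed.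

Lemma decreasing_row_replace R x y : decreasing_row R -> 0 < y ->
  (forall z, z \in R -> z < x -> z < y) -> (forall z, z \in R -> x < z -> y < z) ->
  decreasing_row (replace x y R).
Proof.
case/andP=> /allP pR sR y0 hl hr; apply/andP; split.
  by apply/allP => _ /mapP[z /pR zR ->]; case: eqVneq.
apply: (homo_sorted_in (P := mem R) (e := gtn)) sR; last exact/allP.
move=> u v uR vR /= vu.
case: (eqVneq u x) => [ux|_]; case: (eqVneq v x) => [vx|_].
- lia.
- by apply: hl => //; rewrite -ux.
- by apply: hr => //; rewrite -vx.
- by [].
Qed.

Lemma cnt_replace R x y z : uniq R -> x \in R ->
  cnt z (replace x y R) + (z < x) = cnt z R + (z < y).
Proof.
rewrite /cnt; elim: R => //= w R IH /andP[wR uR]; rewrite inE => /orP[/eqP->|xR].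
  rewrite eqxx -/(replace w y R).
  have -> : replace w y R = R.
    rewrite /replace map_id_in // => v.
    by case: eqVneq => // -> wR'; rewrite wR' in wR.
  lia.
have -> : (w == x) = false by apply: contraNF wR => /eqP->.
by have := IH uR xR; rewrite /replace; lia.
Qed.

Lemma size_replace x y R : size (replace x y R) = size R.
Proof. exact: size_map. Qed.

(** * Effect of an insertion on the counts of a row *)

Definition insert_row (A : seq nat) N :=
  if largest (fun n => n <= N) A is Some n then replace n N A else rcons A N.

Lemma cnt_rcons x R y : cnt x (rcons R y) = cnt x R + (x < y).
Proof. by rewrite /cnt -cats1 count_cat /= addn0. Qed.

(** Insertion raises by one the counts at the thresholds from [n0] to [N'.-1]. The counts of [A] are
    constant there while those of [R] decrease, so only the threshold [N'.-1] is critical. *)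
Lemma fits_above_insert_row R A N' : decreasing_row A -> 0 < N' ->
  fits_above R (insert_row A N') <->
  fits_above R A /\ cnt N' A < cnt N' R.
Proof.
move=> dA N0; have uA := decreasing_row_uniq dA.
(* The default 0 lets an append count as the replacement of a phantom entry 0. *)
pose n0 := odflt 0 (largest (fun n => n <= N') A).
have [n0N n0max cntE] : [/\ n0 <= N', forall z, z \in A -> z <= N' -> z <= n0 &
    forall x, cnt x (insert_row A N') = cnt x A + ((n0 <= x) && (x < N'))].
  rewrite /n0 /insert_row; have := largestP (fun n => n <= N') A.
  case: largest => [n [nA nN nmax]|h] /=; split=> //.
  - by move=> x; have := cnt_replace N' x uA nA; lia.
  - by move=> z /h; lia.
  - by move=> x; rewrite cnt_rcons.
split=> [h|[h1 h2] x].
  split=> [x|]; first by have := h x; rewrite cntE; lia.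
  have := h N'.-1; rewrite cntE prednK //.
  case: (boolP (N' \in A)) => [NA|nNA].
    by rewrite cnt_pred //; lia.
  have -> : cnt N'.-1 A = cnt N' A.
    apply: cnt_gap => [|z zA]; first lia.
    by have : z != N' by [apply: contraNneq nNA => <-]; lia.
  have : n0 != N'.
    rewrite /n0; have := largestP (fun n => n <= N') A.
    case: largest => [n [nA _ _]|_] /=; last lia.
    by apply: contraNneq nNA => <-.
  lia.
rewrite cntE; case: (boolP (_ && _)) => [/andP[n0x xN]|_];
  last by have := h1 x; lia.
have -> : cnt x A = cnt N' A.
  by apply: cnt_gap => [|z zA]; [lia|have := n0max z zA; lia].
by have := @leq_cnt R x.+1 N' xN; lia.
Qed.

(** * Ejectable values and the bump of a single row *)

Lemma ejectable_head Q x : ejectable Q x -> x \in head [::] Q.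
Proof. by case: Q => //= R Q /andP[]. Qed.

Lemma head_ejectable Q x : x \in head [::] Q -> x.-1 \notin head [::] Q ->
  ejectable Q x.
Proof. by case: Q => //= R Q -> ->. Qed.

(** The least entry of the first row inside the gap would lack its predecessor, hence be
    ejectable. *)
Lemma ejectable_gap Q a b : a \notin head [::] Q ->
  (forall z, a < z < b -> ~~ ejectable Q z) ->
  forall z, z \in head [::] Q -> a < z -> b <= z.
Proof.
move=> aQ noE; elim/ltn_ind=> z IH zQ az; rewrite leqNgt; apply/negP => zb.
have := noE z; rewrite az zb => /(_ isT)/negP; apply.
apply: head_ejectable => //; apply/negP => z1Q.
have az1 : a < z.-1.
  have : a != z.-1 by apply: contraNneq aQ => ->.
  by clear -az; lia.
have := IH z.-1 _ z1Q az1; clear -az zb; lia.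
Qed.

(* The value that insertion of [N] into the rows [R :: Q] passes to [Q], where  *)
(* [n] is n_1; the value [0] stands for termination by T2.                     *)
Definition next_value R Q N n :=
  if (n == N) && (N.-1 \in R) then N.-1
  else if (n < N) && ~~ ejectable Q n then n
  else let n2 := nth 0 R (index n R).+1 in
       odflt n2 (largest_ejectable Q n2 n).

(* The cases IR1, IR2 and T2 share one description: [N'] is the largest value   *)
(* below [n] that is an entry of [R], or [Q]-ejectable, or [0].                 *)
Inductive bumps (R : seq nat) Q N n N' : Prop :=
| BumpD of n = N & N' = N.-1 & N.-1 \in R
| BumpDR of n < N & N' = n & ~~ ejectable Q n
| BumpIR of (n = N -> N.-1 \notin R) & (n < N -> ejectable Q n) & N' < n &
    (forall z, z \in R -> z < n -> z <= N') &
    [|| N' \in R, ejectable Q N' | N' == 0] &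
    (forall z, N' < z < n -> ~~ ejectable Q z).

Lemma right_neighbour R n : decreasing_row R -> n \in R ->
  let n2 := nth 0 R (index n R).+1 in
  [/\ n2 < n, (n2 == 0) || (n2 \in R) & forall z, z \in R -> z < n -> z <= n2].
Proof.
move=> dR nR; have n0 := decreasing_row_pos dR nR.
have [_ sR] := andP dR; have jR : index n R < size R by rewrite index_mem.
have nE := nth_index 0 nR; move: (index n R) jR nE => j jR nE n2.
have sn x i : (x < nth 0 R i) = (i < cnt x R) by exact: ltn_nth_cnt.
have cn : cnt n R <= j by rewrite leqNgt -sn nE ltnn.
have cn2 : cnt n2 R <= j.+1 by rewrite leqNgt -sn ltnn.
split.
- have := sn n.-1 j.+1; rewrite -/n2 (cnt_pred (decreasing_row_uniq dR)) //; lia.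
- have [j1|j1] := ltnP j.+1 (size R); first by rewrite mem_nth ?orbT.
  by rewrite /n2 nth_default.
- move=> z zR zn; have zE := nth_index 0 zR; rewrite leqNgt; apply/negP => n2z.
  have := sn n2 (index z R); have := sn z (index z R); have := sn z j.
  by rewrite zE nE; lia.
Qed.

(* [lia] splits on each boolean of the context, so the irrelevant ones go.     *)
Ltac order_lia :=
  repeat match goal with
  | H : context [in_mem _ _] |- _ => clear H
  | H : context [ejectable _ _] |- _ => clear H
  | H : is_true (decreasing_row _) |- _ => clear H
  end; lia.

Lemma next_valueP R Q N n N' : decreasing_row R -> decreasing_row (head [::] Q) ->
  n \in R -> n <= N -> bumps R Q N n N' <-> next_value R Q N n = N'.
Proof.
move=> dR dQ nR nN; have [] := right_neighbour dR nR.
set n2 := nth 0 R _ => n2n n2R n2max; rewrite /next_value -/n2; split.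
  case=> [-> -> ->|nN' -> ->|hD hDR N'n hmax hN' hE]; first by rewrite eqxx.
  - by rewrite nN'; case: eqP => [e|//]; order_lia.
  - have -> : (n == N) && (N.-1 \in R) = false.
      by case: eqP => //= /hD/negPf.
    have -> : (n < N) && ~~ ejectable Q n = false.
      by case: (ltnP n N) => //= /hDR ->.
    have n2N' : n2 <= N'.
      by case/orP: n2R => [/eqP->|n2R] //; apply: hmax.
    rewrite /largest_ejectable; case: (eqVneq N' n2) => [e|N'n2].
      rewrite largest_none ?e // => z _; rewrite -e.
      by apply/negP => /andP[Ez /hE]; rewrite Ez.
    have EN' : ejectable Q N'.
      case/or3P: hN' => // [N'R|/eqP N'0]; last order_lia.
      by have := n2max _ N'R N'n; order_lia.
    rewrite (@largest_eq _ _ N') //; first exact: ejectable_head.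
      by rewrite EN'; order_lia.
    move=> z _ /andP[Ez zn]; rewrite leqNgt; apply/negP => N'z.
    by have := hE z; rewrite Ez; order_lia.
case: ifP => [/andP[/eqP nN' NR] <-|hD]; first exact: BumpD.
case: ifP => [/andP[nN' En] <-|hDR]; first exact: BumpDR.
have {}hD : n = N -> N.-1 \notin R.
  by move=> e; rewrite -e eqxx /= e in hD *; rewrite hD.
have {}hDR : n < N -> ejectable Q n.
  by move=> e; rewrite e /= in hDR; apply: negbFE.
rewrite /largest_ejectable.
have := largestP (fun y => ejectable Q y && (n2 < y < n)) (head [::] Q).
case: largest => [y [yQ /andP[Ey yn] ymax]|h] /= <-; apply: BumpIR => //.
- by order_lia.
- by move=> z zR zn; have := n2max z zR zn; order_lia.
- by rewrite Ey orbT.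
- move=> z zn; apply/negP => Ez.
  by have := ymax z (ejectable_head Ez); rewrite Ez; order_lia.
- by case/orP: n2R => ->; rewrite ?orbT.
- move=> z zn; apply/negP => Ez.
  by have := h z (ejectable_head Ez); rewrite Ez zn.
Qed.

(* With the flag [(0 < N') && ~~ ejectable Q N'], the case [N' = 0] is both the *)
(* step T2 of insertion and the first step of a reverse insertion with alpha    *)
(* equal to 0; the strict inequality then says that the cell is removable.      *)
Lemma bump_forward R Q N n N' :
  decreasing_row R -> decreasing_row (head [::] Q) -> fits_above R (head [::] Q) ->
  n \in R -> n <= N -> (forall z, z \in R -> z <= N -> z <= n) ->
  bumps R Q N n N' -> let R' := replace n N R in
  [/\ decreasing_row R', fits_above R' (head [::] Q),
      cnt N' (head [::] Q) < cnt N' R', smallest (fun x => N' < x) R' = Some N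
    & process_row R' Q N N' ((0 < N') && ~~ ejectable Q N')
      = (R, ~~ ejectable (R :: Q) N)].
Proof.
set A := head [::] Q => dR dA fitR nR nN nmax B R'.
have n0 := decreasing_row_pos dR nR.
have N0 : 0 < N by order_lia.
have memR' z : (z \in R') = (z == N) || (z \in R) && (z != n) by exact: mem_replace.
have cntR' z := cnt_replace N z (decreasing_row_uniq dR) nR; rewrite -/R' in cntR'.
have NR' : N \in R' by rewrite memR' eqxx.
have R'K : replace N n R' = R by apply: replaceK => NR; have := nmax _ NR; order_lia.
have N'N : N' < N by case: B => *; order_lia.
have N1R : N.-1 \in R -> n = N \/ n = N.-1 by move=> h; have := nmax _ h; order_lia.
have NR : n < N -> N \notin R.
  by move=> nN'; apply/negP => h; have := nmax _ h; order_lia.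
split.
- by apply: decreasing_row_replace => // z zR; [order_lia|have := nmax z zR; order_lia].
- by move=> x; have := fitR x; have := cntR' x.+1; order_lia.
- case: B => [nN' -> N1|nN' -> _|_ _ N'n hmax hN' hE].
  + have := fitR N.-1; have := cntR' N.-1; rewrite prednK // => h1 h2.
    have := cnt_pred (decreasing_row_uniq dR) N0; rewrite -nN' nR => /(_ isT).
    by rewrite -nN' in h1 h2 *; order_lia.
  + by have := fitR n; have := @leq_cnt R n n.+1 (leqnSn _); have := cntR' n; order_lia.
  (* If [N'] lies in [A], the threshold [N'.-1] already gives a strict inequality. Otherwise [A] has
     no entry between [N'] and [n], and the entry [n] of [R] provides the extra unit. *)
  + have [N'A|N'A] := boolP (N' \in A).
      have N'0 := decreasing_row_pos dA N'A.
      have := cnt_pred (decreasing_row_uniq dA) N'0 N'A; have := fitR N'.-1.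
      by rewrite prednK //; have := cntR' N'; order_lia.
    have gapA := ejectable_gap N'A hE.
    have -> : cnt N' A = cnt n.-1 A.
      apply: cnt_gap => [|z zA /(gapA z zA)]; first by order_lia.
      by order_lia.
    have := fitR n.-1; rewrite prednK //; have := cntR' N'.
    have := cnt_pred (decreasing_row_uniq dR) n0 nR.
    by have := @leq_cnt R N' n.-1; order_lia.
- apply: smallest_eq => // z; rewrite memR' => /orP[/eqP->//|/andP[zR zn]] N'z.
  have := nmax _ zR; have : z < n -> z <= N'; last by move/eqP: zn; order_lia.
  by case: B => [-> -> _|_ -> _|_ _ _ h _ _ zn']; [order_lia|order_lia|apply: h].
- have N1R' : n <> N.-1 \/ n = N -> (N.-1 \in R') = (N.-1 \in R).
    move=> h; rewrite memR'; have -> : N.-1 == N = false by order_lia.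
    have [e|ne] := eqVneq n (N.-1); first by order_lia.
    by rewrite andbT.
  rewrite /process_row; case: B => [e -> N1|nN' -> En|hD hDR N'n hmax hN' hE].
  + rewrite N1R' ?N1; last by right.
    have -> : R' = R by rewrite /R' e replace_id.
    have NR2 : N \in R by rewrite -e.
    by rewrite /= NR2 N1 (decreasing_row_pos dR N1) /=.
  + have -> : (N.-1 \in R') = false.
      rewrite memR'; apply/negbTE/negP => /orP[|/andP[/N1R]]; order_lia.
    by rewrite n0 En memR' eqxx andbF orbF neq_ltn nN' /= R'K (negPf (NR nN')).
  + have -> : (N.-1 \in R') = false.
      rewrite memR'; apply/negbTE/negP => /orP[|/andP[h]]; first order_lia.
      by case: (N1R h) => e; [rewrite (negPf (hD e)) in h|rewrite e eqxx].
    (* DR does not fire: [N'] survives in [R'], or is ejectable, or is 0. *)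
    have -> : (0 < N') && ~~ ejectable Q N' && (N' \notin R') = false.
      case/or3P: hN' => [h|->|/eqP->]; rewrite ?andbF //.
      have -> : N' \in R'.
        by rewrite memR' h orbC neq_ltn N'n.
      by rewrite andbF.
    (* The bump is undone by IR if [n < N] and by NR if [n = N]. *)
    have [nN'|eN] := ltnP n N; rewrite /smallest_ejectable.
      rewrite (@smallest_eq _ _ n); last first.
      * move=> z _ /andP[Ez zN]; rewrite leqNgt; apply/negP => zn.
        by have := hE z; rewrite Ez; order_lia.
      * by rewrite hDR //; order_lia.
      * exact/ejectable_head/hDR.
      by rewrite R'K /= (negPf (NR nN')).
    have {}eN : n = N by order_lia.
    rewrite smallest_none; last first.
      by move=> z _; apply/negP => /andP[Ez]; rewrite -eN => /hE; rewrite Ez.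
    have -> : R' = R by rewrite /R' eN replace_id.
    have NR2 : N \in R by rewrite -eN.
    by rewrite /= NR2 hD.
Qed.

(** The count hypothesis has two uses: it provides an entry above [N'], and it leaves room to lower
    that entry without breaking the columns. *)
Lemma bump_backward R' Q N' :
  decreasing_row R' -> decreasing_row (head [::] Q) ->
  fits_above R' (head [::] Q) -> cnt N' (head [::] Q) < cnt N' R' ->
  exists m R n,
  [/\ smallest (fun x => N' < x) R' = Some m,
      process_row R' Q m N' ((0 < N') && ~~ ejectable Q N')
      = (R, ~~ ejectable (R :: Q) m),
      decreasing_row R & fits_above R (head [::] Q)] /\
  [/\ 0 < m, largest (fun z => z <= m) R = Some n, bumps R Q m n N'
    & replace n m R = R'].
Proof.
set A := head [::] Q => dR' dA fitR' cntN'.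
have := smallestP (fun x => N' < x) R'; case: smallest => [m|]; last first.
  by move=> /hasPn; rewrite has_count -/(cnt N' R'); order_lia.
case=> mR' N'm mmin; exists m.
have m0 := decreasing_row_pos dR' mR'; have uR' := decreasing_row_uniq dR'.
have gapR' z : z \in R' -> N' < z -> z < m -> False by move=> /mmin h /h; order_lia.
rewrite /process_row; have [m1R'|m1R'] := boolP (m.-1 \in R').
  have N'E : N' = m.-1.
    by have := mmin _ m1R'; order_lia.
  exists R', m; split.
    split=> //; rewrite /= mR' m1R' /= -N'E.
    by rewrite N'E (decreasing_row_pos dR' m1R').
  by split; [|exact: largest_eq|exact: BumpD|exact: replace_id].
(* Shared by DR, with [x = N'], and IR. Lowering [m] to [x] affects only thresholds from [x] to
   [m.-1], where the counts of [R'] all equal the one at [N']; a single inequality at [x.-1]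
   therefore suffices. *)
have replaceR x : x \notin R' -> 0 < x -> N' <= x -> x < m ->
    cnt x.-1 A < cnt N' R' ->
    let R := replace m x R' in
    [/\ decreasing_row R, fits_above R A, largest (fun z => z <= m) R = Some x,
        m \notin R
      & replace x m R = R' /\ forall z, z \in R -> z < x -> z \in R' /\ z <= N'].
  move=> xR' x0 N'x xm cx R.
  have memR z : (z \in R) = (z == x) || (z \in R') && (z != m) by exact: mem_replace.
  have gap z : z \in R' -> z < m -> z <= N'.
    by move=> zR' zm; rewrite leqNgt; apply/negP => /(gapR' _ zR'); apply.
  have ltx z : z \in R' -> z <= N' -> z < x.
    by move=> zR' zN'; have : z != x by [apply: contraNneq xR' => <-]; order_lia.
  split.
  - by apply: decreasing_row_replace => // z zR'; [move/(gap _ zR')/(ltx _ zR')|order_lia].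
  - move=> z; have := cnt_replace x z.+1 uR' mR'; rewrite -/R.
    have := fitR' z; case: (leqP x z.+1) => [xz|]; last by order_lia.
    case: (ltnP z.+1 m) => [zm|]; last by order_lia.
    have -> : cnt z.+1 R' = cnt N' R'.
      apply/esym/cnt_gap; first order_lia.
      by move=> w /mmin wR'; move/wR'; order_lia.
    by have := @leq_cnt A x.-1 z; order_lia.
  - apply: largest_eq; [by rewrite memR eqxx|order_lia|].
    move=> z; rewrite memR => /orP[/eqP-> //|/andP[zR' zm]] zm'.
    by have := gap _ zR'; move/eqP: zm; order_lia.
  - by rewrite memR eqxx andbF orbF; order_lia.
  - split; first by apply: replaceK => xR'2; rewrite xR'2 in xR'.
    move=> z; rewrite memR => /orP[/eqP-> |/andP[zR' zm]] zx; first order_lia.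
    by split=> //; apply: gap => //; order_lia.
case: (boolP (_ && _)) => [/andP[/andP[N'0 En] N'R']|hDR].
  have [|||dR fitR lR mR [RK Rx]] := replaceR N' N'R' N'0 => //.
    (* An entry [N'] of [A] that is not ejectable has its predecessor in [A] too, and the threshold
       [N'.-2] then gives the missing unit. *)
    have [N'A|N'A] := boolP (N' \in A); last first.
      have -> // : cnt N'.-1 A = cnt N' A.
      apply: cnt_gap => [|z zA]; first order_lia.
      by have : z != N' by [apply: contraNneq N'A => <-]; order_lia.
    have N'1A : N'.-1 \in A.
      by apply: contraR En; exact: head_ejectable.
    have := fitR' N'.-2; rewrite prednK; last by have := decreasing_row_pos dA N'1A.
    rewrite cnt_pred //; [|exact: decreasing_row_uniq|exact: decreasing_row_pos N'1A].
    have -> // : cnt N'.-1 R' = cnt N' R'.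
    apply: cnt_gap => [|z zR']; first order_lia.
    by have : z != N' by [apply: contraNneq N'R' => <-]; order_lia.
  exists (replace m N' R'), N'; split; split => //.
    by rewrite /= (negPf mR).
  exact: BumpDR.
have {}hDR : [|| N' \in R', ejectable Q N' | N' == 0].
  move: hDR; rewrite !negb_and !negbK -leqNgt leqn0.
  by case/orP=> [/orP[]|] ->; rewrite ?orbT.
rewrite /smallest_ejectable.
have := smallestP (fun x => ejectable Q x && (N' < x < m)) A.
case: smallest => [x [xA /andP[Ex /andP[N'x xm]] xmin]|Enone].
  have xR' : x \notin R' by apply/negP => /gapR'; apply.
  have [||||dR fitR lR mR [RK Rx]] := replaceR x xR';
      [by order_lia|by order_lia|by []| |].
    by have := @leq_cnt A N' x.-1; order_lia.
  exists (replace m x R'), x; split; split => //.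
    by rewrite /= (negPf mR).
  apply: BumpIR => //; first order_lia.
  - by move=> z zR zx; have [] := Rx z zR zx.
  - case/or3P: hDR => [h|->|->]; rewrite ?orbT //.
    by rewrite mem_replace // h (neq_ltn N' m) N'm orbT.
  - move=> z /andP[N'z zx]; apply/negP => Ez.
    by have := xmin z (ejectable_head Ez); rewrite Ez N'z; order_lia.
exists R', m; split; split => //.
- by rewrite /= mR' m1R'.
- exact: largest_eq.
- apply: BumpIR => //; first by rewrite ltnn.
  + by move=> z zR zm; rewrite leqNgt; apply/negP => /(gapR' _ zR); apply.
  + move=> z N'zm; apply/negP => Ez.
    by have := Enone z (ejectable_head Ez); rewrite Ez N'zm.
- exact: replace_id.
Qed.

(** * Recursion equations and stacking of rows *)

(** Every value passed down is positive, being an entry of [R] or larger than [n2], so 0 can mark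
    T2. *)
Lemma insert_from_cons i R Q N : decreasing_row R ->
  insert_from i (R :: Q) N =
  if largest (fun n => n <= N) R is Some n then
    if 0 < next_value R Q N n then
      let: (Q', rc, a) := insert_from i.+1 Q (next_value R Q N n) in
      (replace n N R :: Q', rc, a)
    else (replace n N R :: Q, (i, (index N (replace n N R)).+1), false)
  else (rcons R N :: Q, (i, (size R).+1), true).
Proof.
move=> dR /=; have := largestP (fun n => n <= N) R.
case: largest => // n [nR _ _]; rewrite /next_value.
case: ifP => [/andP[_ N1R]|_]; first by rewrite (decreasing_row_pos dR N1R).
case: ifP => _; first by rewrite (decreasing_row_pos dR nR).
rewrite /largest_ejectable.
have := largestP (fun y => ejectable Q y && (nth 0 R (index n R).+1 < y < n))
  (head [::] Q).
case: largest => [y [_ /andP[_ /andP[y0 _]] _]|_] //=.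
by rewrite (leq_ltn_trans _ y0).
Qed.

Lemma reverse_insert_cons R Q r c a :
  reverse_insert (R :: Q) r.+2 c a =
  let: (Q', m', a') := reverse_insert Q r.+1 c a in
  let m := odflt 0 (smallest (fun x => m' < x) R) in
  let: (R', a0) := process_row R Q' m m' a' in (R' :: Q', m, a0).
Proof. by []. Qed.

Lemma head_insert_from i Q N :
  head [::] (insert_from i Q N).1.1 = insert_row (head [::] Q) N.
Proof.
case: Q => [|R Q] //=; rewrite /insert_row.
case: largest => [n|] //.
by do ?[case: insert_from => -[? ?] ?|case: ifP => _|
       case: largest_ejectable => [?|]].
Qed.

Lemma decreasing_tableau_cons R Q :
  decreasing_tableau (R :: Q) =
  [&& R != [::], decreasing_row R, dominates R (head [::] Q) & decreasing_tableau Q].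
Proof.
rewrite /decreasing_tableau /decreasing_row; case: Q => [|A Q] /=.
  by rewrite !andbT.
by rewrite -!andbA; do 3 congr (_ && _); do 4 bool_congr.
Qed.

Lemma decreasing_head Q : decreasing_tableau Q -> decreasing_row (head [::] Q).
Proof. by case: Q => // R Q; rewrite decreasing_tableau_cons => /and4P[]. Qed.

Lemma decreasing_tableau_consP R Q :
  decreasing_tableau (R :: Q) <->
  [/\ R != [::], decreasing_row R, fits_above R (head [::] Q) & decreasing_tableau Q].
Proof.
rewrite decreasing_tableau_cons; split=> [/and4P[-> dR + dQ]|[-> dR + dQ]].
  by move/(dominatesP dR (decreasing_head dQ)).
by rewrite dR dQ andbT => h; apply/dominatesP => //; exact: decreasing_head.
Qed.

Lemma removable_first R Q c :
  removable (R :: Q) (1, c) = [&& c == size R, 0 < c & size (head [::] Q) < c].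
Proof. by rewrite /removable /in_diagram /row /= nth0; lia. Qed.

Lemma cnt0 R : decreasing_row R -> cnt 0 R = size R.
Proof. by case/andP=> h _; apply/eqP; rewrite -all_count. Qed.

Lemma decreasing_row_rcons R m :
  decreasing_row (rcons R m) = [&& decreasing_row R, 0 < m & all (fun z => m < z) R].
Proof.
rewrite /decreasing_row all_rcons !(sorted_pairwise gtn_trans) pairwise_rcons.
by rewrite -!andbA; case: (0 < m); rewrite ?andbF //= andbCA andbC -andbA.
Qed.

(** Identifies the start of a reverse insertion with bit 0, which reads the last cell, with a bump
    step for [N' = 0]. *)
Lemma smallest_last R m : decreasing_row R ->
  smallest (fun x => 0 < x) R = Some m ->
  nth 0 R (size R).-1 = m /\ (index m R).+1 = size R.
Proof.
move=> dR e; have := smallestP (fun x => 0 < x) R; rewrite e => -[mR _ mmin].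
have [n2m n2R _] := right_neighbour dR mR.
have jR : index m R < size R by rewrite index_mem.
have iE : (index m R).+1 = size R.
  apply/eqP; rewrite eqn_leq jR leqNgt; apply/negP => j1R.
  have n2R' := mem_nth 0 j1R; have n20 := decreasing_row_pos dR n2R'.
  by have := mmin _ n2R' n20; rewrite leqNgt n2m.
by rewrite -iE nth_index.
Qed.

Lemma fits_above_size R A : decreasing_row A -> fits_above R A -> size A <= size R.
Proof. by move=> dA /(_ 0); rewrite cnt0 // => /leq_trans; apply; apply: count_size. Qed.

(** * Induction on the rows *)

(** The final bit is part of the invariant because the row above consumes it. The offset [i]
    reconciles absolute rows in [insert_from] with relative rows in [reverse_insert]. *)
Lemma insert_fromK Q i N P' rc a : decreasing_tableau Q -> 0 < N ->
  insert_from i Q N = (P', rc, a) ->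
  decreasing_tableau P' /\
  exists r, [/\ rc.1 = i + r, removable P' (r.+1, rc.2)
    & reverse_insert P' r.+1 rc.2 a = (Q, N, ~~ ejectable Q N)].
Proof.
elim: Q i N P' rc a => [|R Q IH] i N P' rc a.
  move=> _ N0 [<- <- <-]; split; last by exists 0; rewrite addn0.
  by rewrite /decreasing_tableau /= N0.
move=> /decreasing_tableau_consP[R0 dR fitR dQ] N0; have dA := decreasing_head dQ.
rewrite insert_from_cons //; have := largestP (fun n => n <= N) R.
case: largest => [n [nR nN nmax]|NR]; last first.
  case=> <- <- <-; split.
    apply/decreasing_tableau_consP; split=> //.
    - by rewrite -size_eq0 size_rcons.
    - rewrite decreasing_row_rcons dR N0; apply/allP => z /NR; lia.
    - by move=> x; rewrite cnt_rcons; have := fitR x; lia.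
  exists 0; split; first by rewrite addn0.
    rewrite removable_first size_rcons eqxx /= ltnS.
    exact: fits_above_size.
  rewrite /= nth_rcons ltnn eqxx -cats1 take_size_cat //.
  (* Being absent from [R], [N] is not ejectable, in agreement with bit 1. *)
  have -> : (N \in R) = false by apply/negP => /NR; rewrite leqnn.
  by case: R R0 {dR fitR NR}.
set N' := next_value R Q N n; set R' := replace n N R.
have B : bumps R Q N n N' by apply/next_valueP.
have [dR' fitR' cntN' sN pN] := bump_forward dR dA fitR nR nN nmax B.
rewrite -/R' in dR' fitR' cntN' sN pN.
have R'0 : R' != [::] by rewrite -size_eq0 size_replace size_eq0.
case: (posnP N') => [N'0|N'0].
  rewrite N'0 /= in cntN' sN pN; have [lastN idxN] := smallest_last dR' sN.
  case=> <- <- <-; split; first exact/decreasing_tableau_consP.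
  exists 0; split; first by rewrite addn0.
    rewrite removable_first idxN eqxx lt0n size_eq0 R'0 /=.
    by move: cntN'; rewrite !cnt0.
  by rewrite /= -[index _ _]/((index N R').+1.-1) idxN lastN pN.
case e : (insert_from i.+1 Q N') => [[Q' rc'] a'] [<- <- <-].
have [dQ' [r [rE remQ' revQ']]] := IH _ _ _ _ _ dQ N'0 e.
split.
  apply/decreasing_tableau_consP; split=> //.
  have := head_insert_from i.+1 Q N'; rewrite e /= => ->.
  exact/fits_above_insert_row.
exists r.+1; split; first by rewrite rE addSnnS.
  exact: remQ'.
by rewrite reverse_insert_cons revQ' sN /=; rewrite N'0 in pN; rewrite pN.
Qed.

(** The induction hypothesis presents the lower rows as the result of inserting some [N'], and
    [fits_above_insert_row] converts the column condition on them into the hypotheses of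
    [bump_backward]. *)
Lemma reverse_insertK P r c a i : decreasing_tableau P -> removable P (r.+1, c) ->
  exists P' m, [/\ reverse_insert P r.+1 c a = (P', m, ~~ ejectable P' m),
    decreasing_tableau P', 0 < m & insert_from i P' m = (P, (i + r, c), a)].
Proof.
elim: P r c a i => [|R' Q' IH] r c a i;
  first by move=> _; rewrite /removable /in_diagram /row nth_nil /=; case: c.
move=> /decreasing_tableau_consP[R'0 dR' fitR' dQ'] rem.
case: r rem => [|r] rem.
  move: rem; rewrite removable_first addn0 => /and3P[/eqP cE c0 szA].
  have dA := decreasing_head dQ'.
  have cntA : cnt 0 (head [::] Q') < cnt 0 R' by rewrite !cnt0 // -cE.
  case: a; last first.
    have [m [R [n [[sm pm dR fitR] [m0 ln B Rn]]]]] :=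
      bump_backward dR' dA fitR' cntA.
    have [lastm idxm] := smallest_last dR' sm.
    have [nR nm] : n \in R /\ n <= m.
      by have := largestP (fun z => z <= m) R; rewrite ln => -[->].
    exists (R :: Q'), m; split=> //.
    - by rewrite /= cE lastm pm.
    - by apply/decreasing_tableau_consP; split=> //; case: R nR {pm dR fitR ln B Rn}.
    - rewrite insert_from_cons // ln.
      have -> : next_value R Q' m n = 0 by apply/next_valueP.
      by rewrite Rn idxm cE.
  case/lastP: R' R'0 dR' fitR' cE cntA => // R m _ dR' fitR' cE cntA.
  have := dR'; rewrite decreasing_row_rcons => /and3P[dR m0 /allP mR].
  have fitR : fits_above R (head [::] Q').
    (* Below the threshold [m] every entry of [R] counts, and removability bounds the row below by
       the length of [R]. *)
    move=> x; have := fitR' x; rewrite cnt_rcons; case: ltnP => [xm _|]; last lia.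
    have -> : cnt x.+1 R = cnt 0 R.
      by apply: eq_in_count => z /mR /=; lia.
    have := @leq_cnt (head [::] Q') 0 x isT; rewrite cnt0 // cnt0 //.
    by move: szA; rewrite cE size_rcons; lia.
  have mNR : (m \in R) = false by apply/negP => /mR; rewrite ltnn.
  rewrite size_rcons in cE; rewrite {}cE in szA c0 *.
  have takeE : take (size R) (rcons R m) = R by rewrite -cats1 take_size_cat.
  have nthE : nth 0 (rcons R m) (size R) = m by rewrite nth_rcons ltnn eqxx.
  have lN : largest (fun n => n <= m) R = None.
    by apply: largest_none => z /mR; lia.
  (* Deleting the only cell of a row removes the row; removability leaves nothing below it. *)
  have [R0|R0] := eqVneq R [::].
    have Q'0 : Q' = [::] by move: szA dQ'; rewrite R0; case: (Q') => [|[|? ?] ?].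
    by exists [::], m; rewrite Q'0 R0.
  exists (R :: Q'), m; split=> //.
  - by rewrite /= takeE nthE mNR; case: (R) R0.
  - exact/decreasing_tableau_consP.
  - by rewrite insert_from_cons // lN.
have remQ' : removable Q' (r.+1, c) by exact: rem.
have [Q [N' [revQ dQ N'0 insQ]]] := IH r c a i.+1 dQ' remQ'.
have dA := decreasing_head dQ.
have hQ' := head_insert_from i.+1 Q N'; rewrite insQ /= in hQ'.
move: fitR'; rewrite hQ' => /(fits_above_insert_row _ dA N'0)[fitR' cntN'].
have [m [R [n [[sm pm dR fitR] [m0 ln B Rn]]]]] :=
  bump_backward dR' dA fitR' cntN'.
have [nR nm] : n \in R /\ n <= m.
  by have := largestP (fun z => z <= m) R; rewrite ln => -[->].
exists (R :: Q), m; split=> //.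
- by rewrite N'0 in pm; rewrite reverse_insert_cons revQ sm /= pm.
- by apply/decreasing_tableau_consP; split=> //; case: R nR {pm dR fitR ln B Rn}.
- rewrite insert_from_cons // ln.
  have -> : next_value R Q m n = N' by apply/next_valueP.
  by rewrite /= N'0 insQ Rn addSnnS.
Qed.

Theorem theorem5p3 :
  (forall (P : tableau) (r c : nat) (a : bool) (P' : tableau) (m : nat),
      decreasing_tableau P -> removable P (r, c) ->
      Psi P (r, c) a = (P', m) ->
      [/\ decreasing_tableau P', 0 < m & Phi P' m = (P, (r, c), a)])
  /\
  (forall (P : tableau) (m : nat) (P' : tableau) (r c : nat) (a : bool),
      decreasing_tableau P -> 0 < m ->
      Phi P m = (P', (r, c), a) ->
      [/\ decreasing_tableau P', removable P' (r, c)
        & Psi P' (r, c) a = (P, m)]).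
Proof.
split=> [P r c a P' m dP rem|P m P' r c a dP m0].
  case: r rem => [//|r] rem; rewrite /Psi /=.
  by have [Q [n [-> dQ n0 ins]]] := reverse_insertK a 1 dP rem => -[<- <-].
rewrite /Phi => /(insert_fromK dP m0)[dP' [r' [/= -> rem rev]]].
by split=> //; rewrite /Psi rev.
Qed.
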